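(* The kernels $\mathcal{K}^{\mathrm{Val}}$ and $\mathcal{K}^{\mathrm{val}}$ of the valley set and valley number statistics are spanned (as $\mathbb{Q}$-vector spaces) in the following ways: (a) $\mathcal{K}^{\mathrm{Val}}=\mathrm{span}\{F_J-F_K : J\twoheadrightarrow_1K\text{ or }J\twoheadrightarrow_2K\}$; (b) $\mathcal{K}^{\mathrm{val}}=\mathrm{span}\{F_J-F_K : J\twoheadrightarrow_1K,\ J\twoheadrightarrow_2K,\text{ or }J\twoheadrightarrow_3K\}$. Here $J,K$ range over all compositions.
   Context: A permutation of length $n$ is a word $\pi=\pi_1\cdots\pi_n$ of $n$ distinct positive integers. Its descent composition is the composition whose parts are the lengths of its maximal increasing consecutive subsequences, in order. An index $i\in\{2,\dots,n-1\}$ is a valley of $\pi$ if $\pi_{i-1}>\pi_i<\pi_{i+1}$; $\mathrm{Val}\,\pi$ is the set of valleys and $\mathrm{val}\,\pi$ the number of valleys. Both depend only on the descent composition, so for a composition $L$ write $\mathrm{Val}\,L$, $\mathrm{val}\,L$ for their values on any permutation with descent composition $L$. For $\mathrm{st}\in\{\mathrm{Val},\mathrm{val}\}$, compositions $J,K$ satisfy $J\sim_{\mathrm{st}}K$ if $\mathrm{st}\,J=\mathrm{st}\,K$ and $|J|=|K|$ ($|L|$ is the sum of the parts; the empty composition of $0$ is allowed). For $L=(j_1,\dots,j_m)$ with $|L|=n$, let $\mathrm{Des}\,L=\{j_1,j_1+j_2,\dots,j_1+\cdots+j_{m-1}\}$ and $F_L=\sum x_{i_1}\cdots x_{i_n}$,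 summed over positive integers $i_1\le\cdots\le i_n$ with $i_j<i_{j+1}$ whenever $j\in\mathrm{Des}\,L$. The $F_L$ form a basis of the $\mathbb{Q}$-algebra $\mathrm{QSym}$ of quasisymmetric functions. The kernel of $\mathrm{st}$ is $\mathcal{K}^{\mathrm{st}}=\mathrm{span}_{\mathbb{Q}}\{F_J-F_K : J\sim_{\mathrm{st}}K\}$. (It is known that these two kernels are ideals of $\mathrm{QSym}$; this is not part of the claim.) For compositions $J=(j_1,\dots,j_m)$ and $K$: - $J\twoheadrightarrow_1K$ if there exists $l\in\{1,\dots,m-1\}$ with $j_l\ge2$, $j_{l+1}=1$, and $K=(j_1,\dots,j_{l-1},j_l+1,j_{l+2},\dots,j_m)$; - $J\twoheadrightarrow_2K$ if $j_1=j_2=1$ (in particular $m\ge2$) and $K=(2,j_3,\dots,j_m)$; - $J\twoheadrightarrow_3K$ if $j_i\ge2$ for all $i\in\{2,3,\dots,m\}$, and there exists $l\in\{1,\dots,m-1\}$ with $j_l\ge2$, and with $j_l>2$ if $l>1$, such that $K=(j_1,\dots,j_{l-1},j_l-1,j_{l+1}+1,j_{l+2},\dots,j_m)$. *)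

(* Defs.v *)
From mathcomp Require Import all_boot all_order all_algebra.
From mathcomp Require Import finmap multiset.
From mathcomp Require Import classical_sets functions.
From mathcomp Require Import zify.

Set Implicit Arguments.
Unset Strict Implicit.
Unset Printing Implicit Defensive.

Import GRing.Theory.

Local Open Scope nat_scope.

Definition is_composition (L : seq nat) : bool := all (leq 1) L.

(* A permutation is any word of distinct positive integers: its letters need
   not be exactly 1, ..., n. *)
Definition is_permutation (p : seq nat) : bool := uniq p && all (leq 1) p.

(* The maximal increasing consecutive subsequences of a word, in order. *)
Fixpoint increasing_runs (p : seq nat) : seq (seq nat) :=
  if p is x :: p' then
    match increasing_runs p' with
    | (y :: r) :: rs =>
        if x < y then (x :: y :: r) :: rs else [:: x] :: (y :: r) :: rs
    | rs => [:: x] :: rs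
    end
  else [::].

Definition descent_composition (p : seq nat) : seq nat :=
  shape (increasing_runs p).

(* Positions are numbered from 1, whereas [nth] counts from 0. *)
Definition letter (p : seq nat) (i : nat) : nat := nth 0 p i.-1.

Definition is_valley (p : seq nat) (i : nat) : bool :=
  [&& 2 <= i, i <= (size p).-1,
      letter p i < letter p i.-1 & letter p i < letter p i.+1].

Definition valley_set (p : seq nat) : {fset nat} :=
  [fset i in iota 1 (size p) | is_valley p i]%fset.

Definition valley_number (p : seq nat) : nat := #|` valley_set p|.

(* [st J] is the value of [st] on any permutation with descent composition [J].
   By [exists_permutation], [valley_set_descent] and [valley_number_descent],
   for the two valley statistics such permutations exist and their choice is
   irrelevant. *)
Definition st_equiv (T : Type) (st : seq nat -> T) (J K : seq nat) : Prop :=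
  (forall p q : seq nat, is_permutation p -> is_permutation q ->
     descent_composition p = J -> descent_composition q = K -> st p = st q)
  /\ sumn J = sumn K.

(* Formal power series over the rationals, given by their coefficients.  The
   monomial [x_{i_1} ... x_{i_n}] is the multiset [{i_1, ..., i_n}]. *)
Definition power_series : lmodType rat := {mset nat}%mset -> rat^o.

Definition Des (L : seq nat) : seq nat :=
  [seq sumn (take k L) | k <- iota 1 (size L).-1].

(* The index sequences (i_1, ..., i_n) over which F_L is summed. *)
Definition F_word (L w : seq nat) : bool :=
  [&& size w == sumn L, all (leq 1) w, sorted leq w &
      all (fun j => letter w j < letter w j.+1) (Des L)].

(* The coefficient of a monomial [m] in F_L is the number of index sequences
   [w] of F_L with monomial [m]; by [mem_permutations_mset] the words with
   monomial [m] are the elements of [permutations m]. *)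
Definition fundamental (L : seq nat) : power_series :=
  fun m => (count (F_word L) (permutations (enum_mset m)))%:R%R.

Section Span.
Local Open Scope ring_scope.
Local Open Scope classical_set_scope.

Definition lspan (k : fieldType) (V : lmodType k) (S : set V) : set V :=
  [set v | exists (n : nat) (c : 'I_n -> k) (g : 'I_n -> V),
     (forall i, S (g i)) /\ v = \sum_(i < n) c i *: g i].

Definition span_differences (r : seq nat -> seq nat -> Prop) :
    set power_series :=
  lspan [set f : power_series | exists J K : seq nat,
     [/\ is_composition J, is_composition K, r J K & f = fundamental J - fundamental K]].

Definition kernel (T : Type) (st : seq nat -> T) : set power_series :=
  span_differences (st_equiv st).

End Span.

Definition arrow1 (J K : seq nat) : Prop :=
  exists (s t : seq nat) (a : nat),
    [/\ 2 <= a, J = s ++ [:: a, 1 & t] & K = s ++ a.+1 :: t].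

Definition arrow2 (J K : seq nat) : Prop :=
  exists t : seq nat, J = [:: 1, 1 & t] /\ K = 2 :: t.

(* Here [l = (size s).+1], so [l > 1] means [s != [::]]. *)
Definition arrow3 (J K : seq nat) : Prop :=
  all (leq 2) (behead J) /\
  exists (s t : seq nat) (a b : nat),
    [/\ 2 <= a, (s != [::] -> 2 < a),
        J = s ++ [:: a, b & t] & K = s ++ [:: a.-1, b.+1 & t]].

Lemma mem_permutations_mset (m : {mset nat}%mset) (w : seq nat) :
  (w \in permutations (enum_mset m)) = (seq_mset w == m).
Proof.
rewrite mem_permutations; apply/idP/eqP => [h|<-].
  by rewrite -[RHS]seq_mset_id; apply/eq_seq_msetP.
by rewrite perm_sym perm_eq_seq_mset.
Qed.

Lemma descent_composition_cons2 (x y : nat) (s : seq nat) :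
  descent_composition [:: x, y & s] =
  if x < y
  then (head 0 (descent_composition (y :: s))).+1
         :: behead (descent_composition (y :: s))
  else 1 :: descent_composition (y :: s).
Proof.
have [r [rs E]] : exists r rs, increasing_runs (y :: s) = (y :: r) :: rs.
  move=> /=; case: (increasing_runs s) => [|[|z r] rs].
  - by exists [::], [::].
  - by exists [::], ([::] :: rs).
  - by case: ifP => _; [exists (z :: r), rs | exists [::], ((z :: r) :: rs)].
rewrite /descent_composition.
have -> : increasing_runs [:: x, y & s] =
    if x < y then [:: x, y & r] :: rs else [:: x] :: (y :: r) :: rs.
  by rewrite -[LHS]/(match increasing_runs (y :: s) with
    | (y :: r) :: rs =>
        if x < y then (x :: y :: r) :: rs else [:: x] :: (y :: r) :: rs
    | rs => [:: x] :: rs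
    end) E.
by rewrite E; case: ifP.
Qed.

Lemma head_descent_composition (x : nat) (s : seq nat) :
  0 < head 0 (descent_composition (x :: s)).
Proof.
by case: s => [|y s] //; rewrite descent_composition_cons2; case: ifP.
Qed.

Lemma sumn_descent_composition (p : seq nat) :
  sumn (descent_composition p) = size p.
Proof.
elim: p => [//|x [//|y s] IH]; rewrite descent_composition_cons2.
have := head_descent_composition y s; move: IH.
case: (descent_composition (y :: s)) => [//|a L] /= IH _.
by case: ifP => _ /=; lia.
Qed.

Lemma descent_composition_ltn (p q : seq nat) (i : nat) :
  descent_composition p = descent_composition q -> i.+1 < size p ->
  (nth 0 p i < nth 0 p i.+1) = (nth 0 q i < nth 0 q i.+1).
Proof.
move=> E; have Esz: size p = size q by rewrite -!sumn_descent_composition E.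
elim: p q i E Esz => [//|x [//|y s] IH] [//|x' [//|y' s']] i E Esz hi.
have hy := head_descent_composition y s.
have hy' := head_descent_composition y' s'.
have [Exy Et] : (x < y) = (x' < y') /\
    descent_composition (y :: s) = descent_composition (y' :: s').
  move: E hy hy'; rewrite !descent_composition_cons2.
  case: (descent_composition (y :: s)) => [//|a L].
  case: (descent_composition (y' :: s')) => [//|a' L'] /=.
  case: ifP => _; case: ifP => _ [] //.
  - by move=> -> ->.
  - by move=> ->; lia.
  - by move=> <-; lia.
  - by move=> -> ->.
case: i hi => [//|i] hi.
by apply: (IH (y' :: s') i Et) => //; apply: succn_inj.
Qed.

Lemma valley_set_descent (p q : seq nat) :
  is_permutation p -> is_permutation q ->
  descent_composition p = descent_composition q -> valley_set p = valley_set q.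
Proof.
move=> /andP[up _] /andP[uq _] E.
have Esz: size p = size q by rewrite -!sumn_descent_composition E.
apply/fsetP => i; rewrite !inE /= -Esz; congr (_ && _).
rewrite /is_valley -Esz /letter.
case: i => [//|[//|i]] /=; case hi: (_ <= _) => //=.
rewrite (descent_composition_ltn E); last by lia.
congr (_ && _).
have dec (s : seq nat) : uniq s -> i.+1 < size s ->
    (nth 0 s i.+1 < nth 0 s i) = ~~ (nth 0 s i < nth 0 s i.+1).
  move=> us hs; rewrite -leqNgt ltn_neqAle nth_uniq //; last exact: ltnW.
  by rewrite gtn_eqF.
rewrite !dec // -?Esz ?(descent_composition_ltn E) //; lia.
Qed.

Lemma valley_number_descent (p q : seq nat) :
  is_permutation p -> is_permutation q ->
  descent_composition p = descent_composition q ->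
  valley_number p = valley_number q.
Proof.
by move=> hp hq E; rewrite /valley_number (valley_set_descent hp hq E).
Qed.

Lemma exists_permutation (L : seq nat) : is_composition L ->
  exists p : seq nat, is_permutation p /\ descent_composition p = L.
Proof.
move=> hL.
suff [p [hp E _]] : exists p : seq nat,
    [/\ is_permutation p, descent_composition p = L &
        all (fun x => x <= sumn L) p] by exists p.
elim: L hL => [_|[//|j] L IH /= hL]; first by exists [::].
have {IH} [p [/andP[up pp] E bp]] := IH hL.
exists (iota (sumn L).+1 j.+1 ++ p); split.
- apply/andP; split.
    rewrite cat_uniq iota_uniq up andbT; apply/hasPn => x /(allP bp) hx.
    by apply/negP; rewrite mem_iota; lia.
  rewrite all_cat pp andbT; apply/allP => x; rewrite mem_iota; lia.
- rewrite -[in RHS]E; move: (sumn L) bp => n bp {hL E up pp L}.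
  elim: j n bp => [|j IHj] n bp.
    case: p bp => [//|y p] /andP[hy _].
    rewrite -[iota _ _ ++ _]/[:: n.+1, y & p] descent_composition_cons2.
    by rewrite ltnNge leqW.
  rewrite -[iota _ _ ++ _]/[:: n.+1, n.+2 & iota n.+3 j ++ p].
  rewrite descent_composition_cons2 ltnSn.
  rewrite -[n.+2 :: _]/(iota n.+2 j.+1 ++ p) IHj //.
  by apply/allP => x /(allP bp); apply: leqW.
- rewrite all_cat; apply/andP; split; apply/allP => x.
    by rewrite mem_iota; lia.
  by move/(allP bp); lia.
Qed.

(* Main.v *)
(** A valley is the first letter of a non-initial increasing run of length at
    least 2, so the valleys of [L = (j_1, ..., j_m)] are the numbers
    [j_1 + ... + j_k + 1] with [1 <= k < m] and [j_(k+1) >= 2].  Arrows 1 and 2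
    absorb every non-initial part equal to 1, and a composition without such
    parts is determined by its size and its valley set.  Between compositions
    without such parts, arrow 3 pushes all the excess to the last part, reaching
    [(1, 2, ..., 2, c)], which is determined by its size and its number of
    valleys. *)
Require Import Defs.
From mathcomp Require Import all_boot all_order all_algebra.
From mathcomp Require Import classical_sets.
From mathcomp Require Import finmap zify.
From Stdlib Require Import Relations.

Set Implicit Arguments.
Unset Strict Implicit.
Unset Printing Implicit Defensive.

Import GRing.Theory.
Local Open Scope nat_scope.

(** * Valleys of a permutation read off its descent composition *)

(** [n] is the sum of the parts before [L], so the run of length [a] starts at position [n.+1]. *)
Fixpoint valleys_from (n : nat) (L : seq nat) : seq nat :=
  if L is a :: L' then
    if 2 <= a then n.+1 :: valleys_from (n + a) L' else valleys_from (n + a) L'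
  else [::].

Definition valleys (L : seq nat) : seq nat :=
  valleys_from (head 0 L) (behead L).

Lemma valleys_from_cat (n : nat) (s t : seq nat) :
  valleys_from n (s ++ t) = valleys_from n s ++ valleys_from (n + sumn s) t.
Proof.
by elim: s n => [|a s IH] n /=; rewrite ?addn0 // IH addnA; case: ifP.
Qed.

Lemma valleys_fromS (n : nat) (L : seq nat) :
  valleys_from n.+1 L = map S (valleys_from n L).
Proof. by elim: L n => [|a L IH] n //=; rewrite addSn IH; case: ifP. Qed.

Lemma size_valleys_from (n : nat) (L : seq nat) :
  size (valleys_from n L) = count (leq 2) L.
Proof. by elim: L n => [|a L IH] n //=; case: ifP => _ /=; rewrite IH. Qed.

Lemma size_valleys (L : seq nat) :
  size (valleys L) = count (leq 2) (behead L).
Proof. exact: size_valleys_from. Qed.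

Lemma path_valleys_from (n : nat) (L : seq nat) :
  path ltn n (valleys_from n L).
Proof.
elim: L n => [|[|a] L IH] n //=; first by rewrite addn0.
case: ifP => a2 /=; rewrite ?ltnSn; apply: (path_le ltn_trans _ (IH _)) => /=.
  by lia.
by lia.
Qed.

Lemma sorted_valleys (L : seq nat) : sorted ltn (valleys L).
Proof. exact: path_sorted (path_valleys_from _ _). Qed.

Lemma head_descent_composition_gt1 (x : nat) (s : seq nat) :
  (1 < head 0 (descent_composition (x :: s))) =
  (s != [::]) && (x < head 0 s).
Proof.
case: s => [|y s] //; rewrite descent_composition_cons2 /=.
by have := head_descent_composition y s; case: ifP => /=.
Qed.

Lemma mem_valley_set (p : seq nat) (i : nat) :
  (i \in valley_set p) = is_valley p i.
Proof.
rewrite !inE /= mem_iota; case V: (is_valley p i); rewrite ?andbT ?andbF //.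
by move: V; rewrite /is_valley => /and4P[]; lia.
Qed.

(** Prepending [x] shifts every valley by one. The only new candidate is position 2, a valley
    exactly when [x > y] and the first run of [y :: s] has length at least 2. *)
Lemma is_valleyE (p : seq nat) (i : nat) : uniq p ->
  is_valley p i = (i \in valleys (descent_composition p)).
Proof.
elim: p i => [|x [|y s] IH] i up.
- by case: i => [|[|i]].
- by case: i => [|[|i]].
have /andP[xys uys] := up.
have := head_descent_composition_gt1 y s.
rewrite descent_composition_cons2.
have {}IH j := IH j uys.
have Esucc j : is_valley [:: x, y & s] j.+2 =
    if j is 0 then [&& s != [::], y < x & y < head 0 s]
    else is_valley (y :: s) j.+1.
  by case: j => [|j]; rewrite /is_valley /letter /=; case: s {IH up xys uys}.
have := head_descent_composition y s.
have xy : x != y by move: xys; rewrite inE negb_or => /andP[].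
(* Valleys are at least 2, hence at least 3 once shifted, so positions 0, 1 and 2 are settled by
   hand. *)
have high j : j < 3 ->
    (j \in map S (valleys (descent_composition (y :: s)))) = false.
  move=> j3; apply/mapP => -[k].
  by rewrite -IH => /and4P[k2 _ _ _] Ek; move: j3; rewrite Ek ltnS ltnNge k2.
have Emap j : (j.+1 \in map S (valleys (descent_composition (y :: s)))) =
              is_valley (y :: s) j by rewrite IH mem_map //; apply: succn_inj.
move: Emap high; rewrite /valleys.
case: (descent_composition (y :: s)) => [//|h L] /= Emap high h0 h1.
have E2 n : valleys_from n.+1 L = map S (valleys_from n L)
  by apply: valleys_fromS.
have small j : j < 2 -> is_valley [:: x, y & s] j = false.
  by rewrite /is_valley => j2; rewrite leqNgt j2.
case: ifP => xlty /=; rewrite ?add1n E2.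
- case: i => [|[|[|i]]].
  + by rewrite small // high.
  + by rewrite small // high.
  + by rewrite Esucc high // (ltnNge y x) (ltnW xlty) andbF.
  + by rewrite Esucc Emap.
have yx : y < x by lia.
rewrite (_ : (if _ then _ else _) =
   (if 1 < h then [:: 2] else [::]) ++ map S (valleys_from h L)); last first.
  by case: ifP.
rewrite mem_cat h1; case: i => [|[|[|i]]].
- by rewrite small // high //; case: ifP.
- by rewrite small // high //; case: ifP.
- by rewrite Esucc high // yx orbF; case: ifP.
- by rewrite Esucc Emap; case: ifP.
Qed.

Lemma valley_setE (p : seq nat) : is_permutation p ->
  valley_set p =i valleys (descent_composition p).
Proof. by case/andP=> up _ i; rewrite mem_valley_set is_valleyE. Qed.

Lemma valley_numberE (p : seq nat) : is_permutation p ->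
  valley_number p = size (valleys (descent_composition p)).
Proof.
move=> hp; apply/perm_size/uniq_perm; first exact: fset_uniq.
  exact: sorted_uniq ltn_trans ltnn _ (sorted_valleys _).
exact: valley_setE.
Qed.

(** The forward direction instantiates [st_equiv], which could otherwise hold vacuously, at
    permutations supplied by [exists_permutation]. *)
Lemma st_equiv_valley_set (J K : seq nat) :
  is_composition J -> is_composition K ->
  st_equiv valley_set J K <-> valleys J = valleys K /\ sumn J = sumn K.
Proof.
move=> cJ cK; split=> [[E Es]|[E Es]]; split=> //.
  have [p [hp Ep]] := exists_permutation cJ.
  have [q [hq Eq]] := exists_permutation cK.
  apply: (irr_sorted_eq ltn_trans ltnn); rewrite ?sorted_valleys // => i.
  by rewrite -Ep -Eq -!valley_setE // (E p q).
move=> p q hp hq Ep Eq; apply/fsetP => i.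
by rewrite !valley_setE // Ep Eq E.
Qed.

Lemma st_equiv_valley_number (J K : seq nat) :
  is_composition J -> is_composition K ->
  st_equiv valley_number J K <->
  size (valleys J) = size (valleys K) /\ sumn J = sumn K.
Proof.
move=> cJ cK; split=> [[E Es]|[E Es]]; split=> //.
  have [p [hp Ep]] := exists_permutation cJ.
  have [q [hq Eq]] := exists_permutation cK.
  by rewrite -Ep -Eq -!valley_numberE // (E p q).
by move=> p q hp hq Ep Eq; rewrite !valley_numberE // Ep Eq.
Qed.

(** * Spans of differences and chains of arrows *)

Section SpanDifferences.
Local Open Scope ring_scope.

Lemma lspan0 (k : fieldType) (V : lmodType k) (S : set V) : lspan S 0.
Proof.
by exists 0%N, (fun=> 0), (fun=> 0); split=> [[]|] //; rewrite big_ord0.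
Qed.

Lemma lspanD (k : fieldType) (V : lmodType k) (S : set V) (u v : V) :
  lspan S u -> lspan S v -> lspan S (u + v).
Proof.
move=> [m [c [g [Sg ->]]]] [n [d [h [Sh ->]]]].
exists (m + n)%N, (fun i => match split i with inl j => c j | inr j => d j end),
  (fun i => match split i with inl j => g j | inr j => h j end).
split=> [i|]; first by case: (split i).
rewrite big_split_ord /=; congr (_ + _); apply: eq_bigr => i _.
  by rewrite (unsplitK (inl i)).
by rewrite (unsplitK (inr i)).
Qed.

Lemma lspanZ (k : fieldType) (V : lmodType k) (S : set V) (a : k) (v : V) :
  lspan S v -> lspan S (a *: v).
Proof.
move=> [n [c [g [Sg ->]]]]; exists n, (fun i => a * c i), g; split=> //.
by rewrite scaler_sumr; apply: eq_bigr => i _; rewrite scalerA.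
Qed.

Lemma lspan_sub (k : fieldType) (V : lmodType k) (S T : set V) :
  (S `<=` lspan T)%classic -> (lspan S `<=` lspan T)%classic.
Proof.
move=> ST _ [n [c [g [Sg ->]]]].
elim/big_ind: _ => [|u v|i _]; [exact: lspan0 | exact: lspanD | ].
by apply/lspanZ/ST.
Qed.

Lemma sub_lspan (k : fieldType) (V : lmodType k) (S : set V) :
  (S `<=` lspan S)%classic.
Proof.
by move=> v Sv; exists 1%N, (fun=> 1), (fun=> v);
  rewrite big_ord1 scale1r.
Qed.

(** Chains must stay inside the compositions, as [span_differences] admits only differences indexed
    by those. *)
Definition on_compositions (r : seq nat -> seq nat -> Prop) (J K : seq nat) :=
  [/\ is_composition J, is_composition K & r J K].

(** Differences telescope along a chain, and a step taken backwards costs a factor -1. *)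
Lemma span_differences_connected (r : seq nat -> seq nat -> Prop)
    (J K : seq nat) :
  clos_refl_sym_trans _ (on_compositions r) J K ->
  span_differences r (fundamental J - fundamental K).
Proof.
elim=> {J K} [J K [cJ cK rJK]|J|J K _ IH|J K L _ IHJ _ IHK].
- by apply: sub_lspan; exists J, K.
- by rewrite subrr; apply: lspan0.
- by rewrite -opprB -scaleN1r; apply: lspanZ.
- by rewrite -[fundamental J](subrK (fundamental K)) -addrA; apply: lspanD.
Qed.

(** Linear algebra ends here: it remains to see that arrows preserve the statistic and that chains
    of arrows join equivalent compositions. *)
Lemma span_differences_eq (r r' : seq nat -> seq nat -> Prop) :
  (forall J K, on_compositions r' J K -> r J K) ->
  (forall J K, on_compositions r J K ->
     clos_refl_sym_trans _ (on_compositions r') J K) ->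
  span_differences r = span_differences r'.
Proof.
move=> sub gen; apply/seteqP; split; apply: lspan_sub.
  by move=> _ [J [K [cJ cK rJK ->]]]; apply/span_differences_connected/gen.
move=> _ [J [K [cJ cK rJK ->]]]; apply: sub_lspan; exists J, K; split=> //.
exact: sub.
Qed.

End SpanDifferences.

(** * Invariance under the arrows *)

Definition arrow12 (J K : seq nat) : Prop := arrow1 J K \/ arrow2 J K.
Definition arrow123 (J K : seq nat) : Prop :=
  arrow1 J K \/ arrow2 J K \/ arrow3 J K.

Notation connected r := (clos_refl_sym_trans (seq nat) (on_compositions r)).

(** A part 1 gives no valley, and merging it into [a >= 2] changes neither the later starting
    positions nor whether that part counts. In arrow 2 the merged part is initial, hence never
    counted. *)
Lemma arrow12_valleys (J K : seq nat) :
  arrow12 J K -> valleys J = valleys K /\ sumn J = sumn K.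
Proof.
case=> [[s [t [a [a2 -> ->]]]]|[t [-> ->]]] //.
split; last by rewrite !sumn_cat /=; lia.
case: s => [|x s]; rewrite /valleys /= ?addn1 // !valleys_from_cat /=.
by rewrite a2 leqW // addn1 addnS.
Qed.

(** The run after the shrunken part starts one position earlier, but every non-initial part stays at
    least 2, so the count is kept. *)
Lemma arrow3_valleys (J K : seq nat) :
  is_composition J -> arrow3 J K ->
  size (valleys J) = size (valleys K) /\ sumn J = sumn K.
Proof.
move=> cJ [nJ [s [t [a [b [a2 a3 EJ EK]]]]]]; subst J K.
split; last by rewrite !sumn_cat /=; lia.
rewrite !size_valleys; case: s a3 nJ cJ => [|x s] /= a3.
  by case/andP; lia.
have {}a3 := a3 isT.
rewrite !all_cat !count_cat /=; lia.
Qed.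

Lemma connected_valleys (T : Type) (st : seq nat -> T)
    (r : seq nat -> seq nat -> Prop) :
  (forall J K, on_compositions r J K -> st J = st K /\ sumn J = sumn K) ->
  forall J K, connected r J K -> st J = st K /\ sumn J = sumn K.
Proof.
move=> inv J K; elim=> {J K} [J K /inv//|//|J K _ [-> ->]//|].
by move=> J K L _ [-> ->] _ [-> ->].
Qed.

Lemma connected_sub (r r' : seq nat -> seq nat -> Prop) (J K : seq nat) :
  (forall J K, r J K -> r' J K) -> connected r J K -> connected r' J K.
Proof.
move=> sub; elim=> {J K}.
- by move=> J K [cJ cK /sub rJK]; apply: rst_step; split.
- by move=> J; apply: rst_refl.
- by move=> J K _; apply: rst_sym.
- by move=> J K L _ JK _; apply: rst_trans JK.
Qed.

(** * Normal forms under arrows 1 and 2 *)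

(** [L] is the prefix already normalised. The next part of [t] is appended to it if at least 2; a
    part 1 is absorbed into the last part of [L]. *)
Lemma connected_absorb (L t : seq nat) :
  L != [::] -> all (leq 2) (behead L) -> is_composition (L ++ t) ->
  exists N, [/\ is_composition N, all (leq 2) (behead N) &
                connected arrow12 (L ++ t) N].
Proof.
elim: t L => [|a t IH] L L0 nL; rewrite /is_composition => cL.
  by exists L; split=> //; rewrite cats0 in cL *; last exact: rst_refl.
have [a2|a1] := leqP 2 a.
  rewrite -cat_rcons; apply: IH; rewrite ?cat_rcons //.
    by case: (L).
  by case: L nL {L0 cL} => //= x L nL; rewrite all_rcons a2.
have {a1} Ea : a = 1 by move: cL; rewrite all_cat /= => /and3P[]; lia.
subst a; case/lastP: L L0 nL cL => // s b _ nL cL.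
have [b2|b1] := leqP 2 b.
  have [||//|N [cN nN sN]] := IH (rcons s b.+1).
  - by case: (s).
  - by case: (s) nL => //= x s'; rewrite !all_rcons; lia.
  - by move: cL; rewrite /is_composition !all_cat !all_rcons /=; lia.
  exists N; split=> //; apply: rst_trans sN; apply: rst_step; split=> //.
    by move: cL; rewrite /is_composition !all_cat !all_rcons /=; lia.
  by left; exists s, t, b; rewrite !cat_rcons.
(* Non-initial parts of [L] are at least 2, so a last part 1 forces [L = [:: 1]], where arrow 2
   applies. *)
case: s nL cL => [_|x s /=] /=; last by rewrite all_rcons; lia.
move=> cL; have {b1} Eb : b = 1 by lia.
subst b; have [//|//|//|N [cN nN sN]] := IH [:: 2].
exists N; split=> //; apply: rst_trans sN; apply: rst_step; split=> //.
by right; exists t.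
Qed.

Lemma connected_normal (J : seq nat) : is_composition J ->
  exists N, [/\ is_composition N, all (leq 2) (behead N) &
                connected arrow12 J N].
Proof.
case: J => [_|x t cJ]; first by exists [::]; split=> //; apply: rst_refl.
exact: (@connected_absorb [:: x]).
Qed.

(** Each part, being at least 2, shows its starting position; the total fixes the last part. Keeping
    [m] and [n] apart lets the induction hypothesis return [m + a = n + b], whence [a = b]. *)
Lemma valleys_from_inj (m n : nat) (L M : seq nat) :
  all (leq 2) L -> all (leq 2) M -> m + sumn L = n + sumn M ->
  valleys_from m L = valleys_from n M -> m = n /\ L = M.
Proof.
elim: L M m n => [|a L IH] [|b M] m n //=.
- by rewrite !addn0.
- by move=> _ /andP[-> _].
- by move=> /andP[-> _].
move=> /andP[a2 nL] /andP[b2 nM] Es; rewrite a2 b2 => -[Emn E].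
have [] := IH M (m + a) (n + b) nL nM _ E; first by lia.
by move=> Eab ->; split=> //; congr (_ :: _); lia.
Qed.

Lemma valleys_inj (J K : seq nat) :
  is_composition J -> is_composition K ->
  all (leq 2) (behead J) -> all (leq 2) (behead K) ->
  sumn J = sumn K -> valleys J = valleys K -> J = K.
Proof.
case: J K => [|x J] [|y K] //=; [by lia | by lia |].
by move=> _ _ nJ nK Es E; have [-> ->] := valleys_from_inj nJ nK Es E.
Qed.

(** * Canonical forms under all three arrows *)

(** The composition (1, 2, ..., 2) with [k] parts: the least values that arrow 3 can leave
    behind. *)
Definition low_parts (k : nat) : seq nat := mkseq (fun i => (0 < i).+1) k.

Lemma low_partsS (k : nat) : low_parts k.+1 = rcons (low_parts k) (0 < k).+1.
Proof. exact: mkseqS. Qed.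

Lemma low_parts_composition (k : nat) : is_composition (low_parts k).
Proof. by apply/allP => _ /mapP[i _ ->]. Qed.

Lemma all_behead_low_parts (k : nat) : all (leq 2) (behead (low_parts k)).
Proof.
case: k => [//|k]; apply/allP => _ /mapP[i + ->].
by rewrite mem_iota; lia.
Qed.

(** Arrow 3 is applied [c] times at the same place, one unit per step; the bounds on [a] keep each
    step legal. *)
Lemma connected_shift (k a b c : nat) (t : seq nat) :
  0 < a -> (0 < k -> 1 < a) -> 1 < b -> all (leq 2) t ->
  connected arrow123 (low_parts k ++ [:: a + c, b & t])
                     (low_parts k ++ [:: a, b + c & t]).
Proof.
move=> a0 ak b2 nt; elim: c b b2 => [|c IH] b b2.
  by rewrite !addn0; apply: rst_refl.
rewrite -(addSnnS b); apply: rst_trans (IH b.+1 (leqW b2)); apply: rst_step.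
have cl := low_parts_composition k.
have ct : all (leq 1) t by apply: sub_all nt; case.
split; rewrite /is_composition ?all_cat ?[all _ (low_parts k)]cl /= ?ct.
- by lia.
- by lia.
right; right; split.
  case: k ak {cl IH} (all_behead_low_parts k) => [|k] ak /=.
    by rewrite b2 nt.
  by rewrite all_cat => -> /=; rewrite b2 nt !andbT; lia.
exists (low_parts k), t, (a + c.+1), b; split=> //; first by lia.
  by case: k ak {cl IH} => // k /(_ isT); lia.
by rewrite addnS.
Qed.

(** A sweep from left to right lowers the part at index [k] to its minimum and carries the surplus
    into the next part. *)
Lemma connected_low (k a : nat) (L : seq nat) :
  0 < a -> (0 < k -> 1 < a) -> all (leq 2) L ->
  exists c, connected arrow123 (low_parts k ++ a :: L)
                               (rcons (low_parts (k + size L)) c).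
Proof.
elim: L k a => [|b L IH] k a a0 ak nL.
  by exists a; rewrite addn0 cats1; apply: rst_refl.
have /andP[b2 {}nL] := nL.
(* [(0 < k).+1] is the least part allowed at index [k]; the rest of [a] goes to [b]. *)
have [||//|c con] := IH k.+1 (b + (a - (0 < k).+1)); [by lia | by lia |].
exists c; rewrite /= addnS -addSn; apply: rst_trans con.
rewrite low_partsS cat_rcons.
have {1}-> : a = (0 < k).+1 + (a - (0 < k).+1) by lia.
by apply: connected_shift => //; lia.
Qed.

Lemma connected_canonical (J : seq nat) : is_composition J -> J != [::] ->
  exists c, connected arrow123 J (rcons (low_parts (size (valleys J))) c).
Proof.
move=> cJ J0; have [N [cN nN JN]] := connected_normal cJ.
have [EV Es] : valleys J = valleys N /\ sumn J = sumn N.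
  by apply: connected_valleys JN => {cJ J0 cN nN} J' K' [_ _ /arrow12_valleys].
(* After normalisation every non-initial part counts as a valley. *)
have EJ : size (valleys J) = size (behead N).
  by rewrite EV size_valleys; apply/eqP; rewrite -all_count.
case: N cN nN JN {EV} Es EJ => [|a L] /=.
  by case: J cJ J0 => //= x J; lia.
move=> /andP[a0 _] nL JN _ ->.
have [//|c con] := @connected_low 0 a L a0 _ nL.
exists c; apply: rst_trans con; apply: connected_sub JN => J' K'.
by case; [left | right; left].
Qed.

(** * Both kernels as spans of arrow differences *)

Theorem theorem5p1 :
  kernel valley_set = span_differences (fun J K => arrow1 J K \/ arrow2 J K)
  /\
  kernel valley_number =
    span_differences (fun J K => arrow1 J K \/ arrow2 J K \/ arrow3 J K).
Proof.
have inv3 J K : on_compositions arrow123 J K ->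
    size (valleys J) = size (valleys K) /\ sumn J = sumn K.
  case=> cJ cK; case=> [a1|[a2|]]; last exact: arrow3_valleys.
    by have [|-> ->] := @arrow12_valleys J K; [left|].
  by have [|-> ->] := @arrow12_valleys J K; [right|].
have inv2 J K : on_compositions arrow12 J K ->
    valleys J = valleys K /\ sumn J = sumn K.
  by case=> _ _; apply: arrow12_valleys.
split; apply: span_differences_eq => J K.
- by move=> JK; have [cJ cK _] := JK; apply/st_equiv_valley_set/inv2.
- case=> cJ cK /(st_equiv_valley_set cJ cK)[EV Es].
  have [M [cM nM JM]] := connected_normal cJ.
  have [N [cN nN KN]] := connected_normal cK.
  have [EVM EsM] := connected_valleys inv2 JM.
  have [EVN EsN] := connected_valleys inv2 KN.
  rewrite (@valleys_inj M N) -?EVM -?EVN -?EsM -?EsN // in JM.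
  by apply: rst_trans JM _; apply: rst_sym.
- by move=> JK; have [cJ cK _] := JK; apply/st_equiv_valley_number/inv3.
case=> cJ cK /(st_equiv_valley_number cJ cK)[EV Es].
(* The empty composition has no canonical form, since [rcons] is never empty; it is equivalent only
   to itself. *)
case: (eqVneq J [::]) => [E0|J0].
  subst J; case: K cK Es {cJ EV} => [|x K] /=; last by lia.
  by move=> _ _; apply: rst_refl.
have K0 : K != [::].
  by case: K {cK EV} Es => //; case: J cJ J0 => [|x J] //= /andP[]; lia.
have [c Jc] := connected_canonical cJ J0.
have [d Kd] := connected_canonical cK K0.
have [_ EsJ] := connected_valleys inv3 Jc.
have [_ EsK] := connected_valleys inv3 Kd.
(* Both canonical forms have the same low parts, so equal sizes force equal last parts. *)
have Ecd : c = d by move: EsJ EsK; rewrite EV -!cats1 !sumn_cat /=; lia.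
by apply: rst_trans Jc _; rewrite EV Ecd; apply: rst_sym.
Qed.
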